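(* Let $R$ be a commutative Noetherian ring and let $F = \big(0 \to F_b \xrightarrow{\partial_b} F_{b-1} \to \cdots \to F_{a+1} \xrightarrow{\partial_{a+1}} F_a \to 0\big)$ be a bounded complex of free $R$-modules of finite rank. For each $n \in \mathbb{Z}$ set $s_n = \sum_{i \le n} (-1)^{n-i} \operatorname{rank}_R F_i$. Then $$\dim_R F = \sup\{\dim(R/I_{s_n}(\partial_{n+1})) - n \mid n \in \mathbb{Z}\}.$$
   Context: Complexes are graded homologically: $\partial_n : F_n \to F_{n-1}$, with $F_n = 0$ for $n \notin [a,b]$. Dimension of a complex (Foxby): for an $R$-complex $X$, $\dim_R X = \sup\{\dim(R/\mathfrak{p}) - \inf H(X)_{\mathfrak{p}} \mid \mathfrak{p} \in \operatorname{Spec} R\}$, where $\inf H(X)_{\mathfrak{p}} = \inf\{n \mid H_n(X)_{\mathfrak{p}} \neq 0\}$ and $\dim$ of a ring is Krull dimension. Primes with $H(X)_{\mathfrak p} = 0$ have $\inf H(X)_{\mathfrak p} = \infty$ and contribute $-\infty$. The dimension of the zero ring or zero module is $-\infty$. Suprema are taken in $\mathbb{Z} \cup \{\pm\infty\}$. Ideals of minors: for a map $\varphi$ between free modules of finite rank, $I_s(\varphi)$ is the ideal of $R$ generated by the $s \times s$ minors of a matrix representing $\varphi$. Conventions: for $s \le 0$ an $s \times s$ minor of any matrix is $1$, so $I_s(\varphi) = R$. For $s \ge 1$, an $s \times s$ minor of a non-empty matrix is $0$ if $s$ exceeds the number of rows or columns. All minors of the empty ($0 \times 0$) matrix are $1$.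 A matrix of size $f \times 0$ or $0 \times f$ with $f \ge 1$ is regarded as non-empty, so its $s \times s$ minors with $s\ge 1$ are $0$. In particular $I_{s_n}(\partial_{n+1}) = R$ for integers $n$ outside $[a,b]$. *)

(* Defs.v *)
From HB Require Import structures.
From mathcomp Require Import all_boot all_order all_algebra.
From mathcomp Require Import generic_quotient ring_quotient.
From mathcomp Require Import boolp classical_sets functions cardinality fsbigop.
From mathcomp Require Import constructive_ereal ring.

Set Implicit Arguments.
Unset Strict Implicit.
Unset Printing Implicit Defensive.

Import Order.TTheory GRing.Theory Num.Theory.

Local Open Scope classical_set_scope.
Local Open Scope ring_scope.
Local Open Scope quotient_scope.

(* Suprema and infima in Z U {-oo, +oo}, where they always exist. *)
Definition esup (A : set (\bar int)) : \bar int := supremum -oo%E A.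
Definition einf (A : set (\bar int)) : \bar int := infimum +oo%E A.

Section Ideals.
Variable R : comPzRingType.

(* The library's [idealr] excludes the unit ideal and the zero ring, both of
   which are allowed here. *)
Definition is_ideal (I : set R) : Prop :=
  [/\ I 0, forall x y, I x -> I y -> I (x + y) & forall a x, I x -> I (a * x)].

Record ideal := Ideal { ideal_set :> set R; idealP : is_ideal ideal_set }.

Definition is_prime (P : set R) : Prop :=
  [/\ is_ideal P, ~ P 1 & forall x y, P (x * y) -> P x \/ P y].

Record spec := Spec { spec_set :> set R; specP : is_prime spec_set }.

Definition ideal_of_spec (p : spec) : ideal :=
  Ideal (let: And3 pI _ _ := specP p in pI).

Lemma generated_is_ideal (S : set R) : is_ideal (smallest is_ideal S).
Proof.
split=> [J [[J0 _ _] _] //|x y Sx Sy J JS|a x Sx J JS].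
  by case: (JS) => -[_ JD _] _; apply: JD; [apply: Sx|apply: Sy].
by case: (JS) => -[_ _ JM] _; apply: JM; apply: Sx.
Qed.

Definition generated (S : set R) : ideal := Ideal (generated_is_ideal S).

Definition noetherian : Prop :=
  forall I : ideal, exists2 S : set R, finite_set S & I = generated S :> set R.

(* Krull dimension; -oo if there is no prime, i.e. for the zero ring. *)
Definition prime_chain (l : nat) (p : nat -> set R) : Prop :=
  (forall i, (i <= l)%N -> is_prime (p i)) /\
  (forall i, (i < l)%N -> p i `<` p i.+1).

Definition krull_dim : \bar int :=
  esup [set (l%:Z)%:E | l in [set l : nat | exists p, prime_chain l p]].

End Ideals.

(* The quotient ring R/I; it is the zero ring when I is the unit ideal. *)
Section QuotientRing.
Variables (R : comPzRingType) (I : ideal R).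

Definition ideal_pred : {pred R} := fun x => `[< ideal_set I x >].

Lemma ideal_pred_zmod_closed : zmod_closed ideal_pred.
Proof.
have [I0 ID IM] := idealP I.
split=> [|x y /asboolP Ix /asboolP Iy]; apply/asboolP => //.
by apply: ID => //; rewrite -mulN1r; apply: IM.
Qed.

HB.instance Definition _ := GRing.isZmodClosed.Build R ideal_pred
  ideal_pred_zmod_closed.

Lemma ideal_predMr a x : x \in ideal_pred -> a * x \in ideal_pred.
Proof. by have [_ _ IM] := idealP I; move=> /asboolP Ix; apply/asboolP/IM. Qed.

Definition quotient_ring := Quotient.quot (ideal_pred : zmodClosed R).

HB.instance Definition _ :
    EqQuotient R (Quotient.equiv (ideal_pred : zmodClosed R)) quotient_ring :=
  EqQuotient.on quotient_ring.
HB.instance Definition _ := GRing.Zmodule.on quotient_ring.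

Let Q := quotient_ring.

Definition qone : Q := \pi_Q 1.
Definition qmul (x y : Q) : Q := \pi_Q (repr x * repr y).

Lemma pi_eqP (x y : R) : (\pi_Q x = \pi_Q y) <-> (x - y \in ideal_pred).
Proof. by split=> [/eqP|H]; [|apply/eqP]; rewrite -Quotient.idealrBE. Qed.

Lemma pi_qadd (x y : R) : \pi_Q (x + y) = \pi_Q x + \pi_Q y.
Proof. exact: Quotient.pi_add. Qed.

Lemma pi_qmul (x y : R) : \pi_Q (x * y) = qmul (\pi_Q x) (\pi_Q y).
Proof.
rewrite /qmul; set x' := repr _; set y' := repr _; apply/pi_eqP.
have Hx : x - x' \in ideal_pred by apply/pi_eqP; rewrite reprK.
have Hy : y - y' \in ideal_pred by apply/pi_eqP; rewrite reprK.
have -> : x * y - x' * y' = y * (x - x') + x' * (y - y').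
  by rewrite !mulrBr [y * x']mulrC addrA subrK [y * x]mulrC.
by rewrite rpredD // ideal_predMr.
Qed.

Lemma qmulA : associative qmul.
Proof.
elim/quotW=> x; elim/quotW=> y; elim/quotW=> z.
by rewrite -(pi_qmul y z) -(pi_qmul x y) -(pi_qmul x) -(pi_qmul (x * y)) mulrA.
Qed.

Lemma qmulC : commutative qmul.
Proof.
elim/quotW=> x; elim/quotW=> y.
by rewrite -(pi_qmul x y) -(pi_qmul y x) mulrC.
Qed.

Lemma qmul1 : left_id qone qmul.
Proof. by elim/quotW=> x; rewrite -(pi_qmul 1 x) mul1r. Qed.

Lemma qmulDl : left_distributive qmul +%R.
Proof.
elim/quotW=> x; elim/quotW=> y; elim/quotW=> z.
rewrite -(pi_qadd x y) -(pi_qmul x z) -(pi_qmul y z) -(pi_qmul (x + y) z).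
by rewrite mulrDl pi_qadd.
Qed.

HB.instance Definition _ := GRing.Zmodule_isComPzRing.Build quotient_ring
  qmulA qmulC qmul1 qmulDl.

End QuotientRing.

Definition dim_quotient (R : comPzRingType) (I : ideal R) : \bar int :=
  krull_dim (quotient_ring I).

Section QuotientModule.
Variables (R : pzRingType) (V : lmodType R) (W : submodClosed V).

(* [submodClosed] does not inherit from [zmodClosed] in the library. *)
Definition submod_pred : {pred V} := fun x => x \in W.

Lemma submod_pred_zmod_closed : zmod_closed submod_pred.
Proof. exact: GRing.submod_closedB (submodClosedP W). Qed.

HB.instance Definition _ := GRing.isZmodClosed.Build V submod_pred
  submod_pred_zmod_closed.

Definition quotient_module := Quotient.quot (submod_pred : zmodClosed V).

HB.instance Definition _ :
    EqQuotient V (Quotient.equiv (submod_pred : zmodClosed V)) quotient_module :=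
  EqQuotient.on quotient_module.
HB.instance Definition _ := GRing.Zmodule.on quotient_module.

Let Q := quotient_module.

Definition qscale (a : R) (x : Q) : Q := \pi_Q (a *: repr x).

Lemma pi_qmodE (x y : V) : (\pi_Q x = \pi_Q y) <-> (x - y \in submod_pred).
Proof. by split=> [/eqP|H]; [|apply/eqP]; rewrite -Quotient.idealrBE. Qed.

Lemma pi_qmodD (x y : V) : \pi_Q (x + y) = \pi_Q x + \pi_Q y.
Proof. exact: Quotient.pi_add. Qed.

Lemma pi_qscale a (x : V) : \pi_Q (a *: x) = qscale a (\pi_Q x).
Proof.
apply/pi_qmodE; rewrite -scalerBr; apply: (rpredZ a : {in W, _}).
by apply/pi_qmodE; rewrite reprK.
Qed.

Lemma qscaleA a b (x : Q) : qscale a (qscale b x) = qscale (a * b) x.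
Proof.
elim/quotW: x => x.
by rewrite -(pi_qscale b x) -(pi_qscale a) -(pi_qscale _ x) scalerA.
Qed.

Lemma qscale1 : left_id 1 qscale.
Proof. by elim/quotW=> x; rewrite -(pi_qscale 1 x) scale1r. Qed.

Lemma qscaleDr : right_distributive qscale +%R.
Proof.
move=> a; elim/quotW=> x; elim/quotW=> y.
rewrite -(pi_qmodD x y) -(pi_qscale a x) -(pi_qscale a y).
by rewrite -(pi_qscale a (x + y)) scalerDr pi_qmodD.
Qed.

Lemma qscaleDl (x : Q) : {morph qscale^~ x : a b / a + b}.
Proof.
elim/quotW: x => x a b.
rewrite -(pi_qscale a x) -(pi_qscale b x) -(pi_qscale (a + b) x).
by rewrite scalerDl pi_qmodD.
Qed.

HB.instance Definition _ := GRing.Zmodule_isLmodule.Build R quotient_module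
  qscaleA qscale1 qscaleDr qscaleDl.

End QuotientModule.

(* The localization M_p: fractions m/s with s outside p, where m/s = m'/s' iff
   u (s' m - s m') = 0 for some u outside p.  Only the underlying set with its
   zero element is needed. *)
Section Localization.
Variables (R : comPzRingType) (M : lmodType R) (p : spec R).

Definition outside := {s : R | `[< ~ spec_set p s >]}.

Definition frac_eq (x y : M * outside) : bool :=
  `[< exists u : outside,
        val u *: (val y.2 *: x.1 - val x.2 *: y.1) = 0 >].

Lemma outside1P : `[< ~ spec_set p 1 >].
Proof. by apply/asboolP; case: (specP p). Qed.

Definition outside1 : outside := Sub 1 outside1P.

Lemma outsideMP (s t : outside) : `[< ~ spec_set p (val s * val t) >].
Proof.
have [_ _ pM] := specP p.
by apply/asboolP => /pM[]; apply/asboolP; [exact: valP s|exact: valP t].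
Qed.

Definition outsideM (s t : outside) : outside :=
  Sub (val s * val t) (outsideMP s t).

Lemma frac_eq_equiv : equiv_class_of frac_eq.
Proof.
have sym x y : frac_eq x y -> frac_eq y x.
  move=> /asboolP[u Hu]; apply/asboolP; exists u.
  by apply/oppr_inj; rewrite oppr0 -scalerN opprB.
split=> [x|x y|y x z].
- by apply/asboolP; exists outside1; rewrite subrr scaler0.
- by apply/idP/idP; apply: sym.
- case: x y z => [m s] [n t] [k w] /asboolP[/= u Hu] /asboolP[/= v Hv].
  apply/asboolP; exists (outsideM (outsideM u v) t) => /=.
  have -> : (val u * val v * val t) *: (val w *: m - val s *: k)
    = (val v * val w) *: (val u *: (val t *: m - val s *: n))
    + (val u * val s) *: (val v *: (val w *: n - val t *: k)).
    have E1 : val v * val w * val u * val t = val u * val v * val t * val w.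
      by ring.
    have E2 : val v * val w * val u * val s = val u * val s * val v * val w.
      by ring.
    have E3 : val u * val s * val v * val t = val u * val v * val t * val s.
      by ring.
    by rewrite !scalerBr !scalerA E1 E2 E3 addrA subrK.
  by rewrite Hu Hv !scaler0 addr0.
Qed.

Canonical frac_equiv := EquivRelPack frac_eq_equiv.
Canonical frac_encModRel := defaultEncModRel frac_eq.

Definition localization := {eq_quot frac_eq}.

Definition frac (m : M) (s : outside) : localization := \pi_localization (m, s).

Definition localization_neq0 : Prop :=
  exists x : localization, x <> frac 0 outside1.

End Localization.

(* The differentials are indexed by pairs of degrees: [diff i j] is the
   differential X_i -> X_j when i = j + 1, and is zero otherwise.  This avoids
   transports along j + 1 - 1 = j. *)
Record complex (R : comPzRingType) := Complex {
  obj :> int -> lmodType R;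
  diff : forall i j : int, {linear obj i -> obj j};
  diff_shape : forall i j x, i != j + 1 -> diff i j x = 0;
  diffK : forall i j k x, diff j k (diff i j x) = 0
}.

Section Homology.
Variables (R : comPzRingType) (X : complex R) (n : int).

Definition cycle_pred : {pred X n} := fun x => diff X n (n - 1) x == 0.

Lemma cycle_pred_closed : submod_closed cycle_pred.
Proof.
split=> [|a x y /eqP dx /eqP dy]; apply/eqP; first exact: linear0.
by rewrite linearP dx dy scaler0 addr0.
Qed.

HB.instance Definition _ := GRing.isSubmodClosed.Build R (X n) cycle_pred
  cycle_pred_closed.

Definition cycles := {x : X n | x \in cycle_pred}.

HB.instance Definition _ := SubChoice.on cycles.
HB.instance Definition _ := [SubChoice_isSubLmodule of cycles by <:].

Definition boundary_pred : {pred cycles} :=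
  fun z => `[< exists y : X (n + 1), diff X (n + 1) n y = val z >].

Lemma boundary_pred_closed : submod_closed boundary_pred.
Proof.
split=> [|a x y /asboolP[u Hu] /asboolP[v Hv]]; apply/asboolP.
  by exists 0; rewrite !linear0.
by exists (a *: u + v); rewrite linearP Hu Hv linearP.
Qed.

HB.instance Definition _ := GRing.isSubmodClosed.Build R cycles boundary_pred
  boundary_pred_closed.

Definition homology : lmodType R :=
  quotient_module (boundary_pred : submodClosed cycles).

End Homology.

Section Dimension.
Variables (R : comPzRingType) (X : complex R).

Definition inf_homology_at (p : spec R) : \bar int :=
  einf [set n%:E | n in [set n : int | localization_neq0 (homology X n) p]].

(* In [\bar int], x - +oo = -oo for every x, including x = +oo; hence a prime
   at which the homology vanishes contributes -oo. *)
Definition dim_complex : \bar int :=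
  esup [set (dim_quotient (ideal_of_spec p) - inf_homology_at p)%E
       | p in [set: spec R]].

End Dimension.

Section Minors.
Variable R : comPzRingType.

Definition is_basis (M : lmodType R) (r : nat) (e : 'I_r -> M) : Prop :=
  forall x : M, exists! c : {ffun 'I_r -> R}, x = \sum_i c i *: e i.

Definition represents (M N : lmodType R) (m n : nat) (phi : M -> N)
    (e : 'I_m -> M) (f : 'I_n -> N) (A : 'M[R]_(n, m)) : Prop :=
  forall j, phi (e j) = \sum_i A i j *: f i.

(* The conventions for s <= 0, for the 0 x 0 matrix, and for s exceeding the
   number of rows or columns, in this order. *)
Definition minors (s : int) (m n : nat) (A : 'M[R]_(m, n)) : set R :=
  if (s <= 0) || ((m == 0%N) && (n == 0%N)) then [set 1]
  else if (minn m n < `|s|)%N then [set 0]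
  else [set x | exists (f : 'I_`|s| -> 'I_m) (g : 'I_`|s| -> 'I_n),
         [/\ {homo f : i j / (i < j)%N}, {homo g : i j / (i < j)%N}
           & x = \det (mxsub f g A)]].

Definition minors_ideal (s : int) (m n : nat) (A : 'M[R]_(m, n)) : ideal R :=
  generated (minors s A).

End Minors.

(* The sum over all i <= n, meaningful because rk has bounded support. *)
Definition alt_rank (rk : int -> nat) (n : int) : int :=
  \sum_(i \in [set i : int | i <= n]) (-1) ^ (n - i) * (rk i)%:Z.

(* Main.v *)
(* Localizing at a prime p, let n be the least degree with H_n(F)_p <> 0.  Below
   n the complex splits at p, so the rank of F_{i+1} -> F_i over the residue
   field of p is s_i for i < n.  Given the splitting below n, the following are
   equivalent: H_n(F)_p = 0; F splits in degree n at p; the ranks of the two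
   differentials at F_n add up to rank F_n; I_{s_n} is not contained in p.
   Hence n is also the least degree with I_{s_n} contained in p, and both sides
   are suprema over the same chains of primes.  "At p" is expressed over R by
   allowing multipliers outside p, so no localization of F is formed. *)
From HB Require Import structures.
Require Import Defs.
From mathcomp Require Import all_boot all_order all_algebra.
From mathcomp Require Import perm boolp classical_sets cardinality fsbigop.
From mathcomp Require Import constructive_ereal zify.

Set Implicit Arguments.
Unset Strict Implicit.
Unset Printing Implicit Defensive.

Import Order.TTheory GRing.Theory Num.Theory.

Local Open Scope classical_set_scope.
Local Open Scope ring_scope.
Local Open Scope quotient_scope.

(** * Minors and rank over a field *)

Lemma injective_ord_sorted (s m : nat) (f : 'I_s -> 'I_m) : injective f ->
  exists (g : 'I_s -> 'I_m) (p : 'S_s),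
    {homo g : i j / (i < j)%N} /\ forall i, f i = g (p i).
Proof.
move=> f_inj; pose S := [set f i | i : 'I_s]%SET.
have cardS : s = #|S| by rewrite card_imset // card_ord.
have Sf i : f i \in S by apply: imset_f.
pose h i := cast_ord (esym cardS) (enum_rank_in (Sf i) (f i)).
have hK i : enum_val (cast_ord cardS (h i)) = f i.
  by rewrite /h cast_ordKV enum_rankK_in.
have h_inj : injective h by move=> i j hij; apply: f_inj; rewrite -!hK hij.
exists (fun i => enum_val (cast_ord cardS i)), (perm h_inj).
split=> [i j ij|i].
  have x0 : 'I_m := f i.
  have lt_size (k : 'I_#|S|) : (k < size (enum S))%N by rewrite -cardE.
  rewrite !(enum_val_nth x0) -!(nth_map x0 0%N val) ?lt_size //.
  apply: (sorted_ltn_nth ltn_trans) => //; rewrite ?inE ?size_map ?lt_size //.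
  (* The enumeration of [S] filters that of ['I_m], whose values are [iota 0 m]. *)
  apply: (subseq_sorted ltn_trans _ (iota_ltn_sorted 0 m)).
  rewrite -val_enum_ord; apply: map_subseq.
  by rewrite enumT; apply: filter_subseq.
by rewrite permE hK.
Qed.

(** Select independent rows, then independent columns among them. These selections are merely
    injective; sorting them permutes rows and columns, which changes the determinant by a sign
    only. *)
Lemma exists_minor_neq0 (K : fieldType) (m n s : nat) (A : 'M[K]_(m, n)) :
  \rank A = s -> exists (f : 'I_s -> 'I_m) (g : 'I_s -> 'I_n),
    [/\ {homo f : i j / (i < j)%N}, {homo g : i j / (i < j)%N}
      & \det (mxsub f g A) != 0].
Proof.
move=> <-{s}.
have [f [p [f_mono fE]]] := injective_ord_sorted (@maxrankfun_inj _ _ _ A).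
have free_full : row_full (rowsub (maxrankfun A) A)^T.
  by rewrite /row_full mxrank_tr; apply: maxrowsub_free.
have [g [q [g_mono gE]]] :=
  injective_ord_sorted (@fullrankfun_inj _ _ _ _ free_full).
exists f, g; split=> //; have := fullrowsub_unit free_full.
have -> : rowsub (fullrankfun free_full) (rowsub (maxrankfun A) A)^T =
    row_perm q (col_perm p (mxsub f g A)^T).
  by apply/matrixP => i j; rewrite !mxE gE fE.
rewrite row_permE col_permE unitmxE !det_mulmx !unitrM !det_perm det_tr.
by rewrite !unitfE => /and3P[].
Qed.

Lemma minor_neq0_rank (K : fieldType) (m n s : nat) (A : 'M[K]_(m, n))
    (f : 'I_s -> 'I_m) (g : 'I_s -> 'I_n) :
  \det (mxsub f g A) != 0 -> (s <= \rank A)%N.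
Proof.
rewrite -unitfE -unitmxE => /mxrank_unit {1}<-.
have -> : mxsub f g A = colsub g (rowsub f A)
  by apply/matrixP => i j; rewrite !mxE.
rewrite -mxrank_tr trmx_mxsub; apply: leq_trans (mxrankS (rowsub_sub _ _)) _.
by rewrite mxrank_tr; apply: mxrankS (rowsub_sub _ _).
Qed.

(** * Exactness and splitting of matrices up to a multiplier *)

Section SplitExact.
Variables (R : comPzRingType) (K : fieldType) (phi : {rmorphism R -> K}).
(** The model is the residue field of a prime p with kernel p, so that [phi u != 0] says that u
    becomes invertible in the localization at p. *)
Hypothesis phi_frac :
  forall z : K, exists a s : R, phi s != 0 /\ phi s * z = phi a.

Lemma mx_common_denominator (m n : nat) (T : 'M[K]_(m, n)) :
  exists (T' : 'M[R]_(m, n)) (s : R), phi s != 0 /\ map_mx phi T' = phi s *: T.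
Proof.
have [num numP] := choice (fun z => phi_frac z).
have [den denP] := choice numP.
pose d i j := den (T i j); pose s := \prod_i \prod_j d i j.
(* [s' i j] is the product [s] of all denominators with that of the entry (i, j) left out. *)
pose s' i j :=
  (\prod_(j' | j' != j) d i j') * (\prod_(i' | i' != i) \prod_j' d i' j').
exists (\matrix_(i, j) (s' i j * num (T i j))), s; split.
  rewrite rmorph_prod; apply/prodf_neq0 => i _; rewrite rmorph_prod.
  by apply/prodf_neq0 => j _; case: (denP (T i j)).
apply/matrixP => i j; rewrite !mxE rmorphM; case: (denP (T i j)) => _ <-.
rewrite mulrA -rmorphM; congr (phi _ * _).
by rewrite /s (bigD1 i) //= (bigD1 j) //= /s' mulrC mulrA.
Qed.

(** Over [K] the splitting writes an invertible scalar matrix as a sum of matrices of ranks at most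
    those of [B] and [A]; the opposite inequality comes from [A *m B = 0]. *)
Lemma split_rank (l m n : nat) (A : 'M[R]_(l, m)) (B : 'M[R]_(m, n)) u s t :
  phi u != 0 -> A *m B = 0 -> B *m s + t *m A = u%:M ->
  (\rank (map_mx phi A) + \rank (map_mx phi B) = m)%N.
Proof.
move=> u0 AB0 split; apply/eqP; rewrite eqn_leq mulmx0_rank_max; last first.
  by rewrite -map_mxM AB0 map_mx0.
have rank_u : \rank (map_mx phi (u%:M : 'M_m)) = m.
  by rewrite map_scalar_mx -scalemx1 mxrank_scale_nz // mxrank1.
rewrite andTb -[X in (X <= _)%N]rank_u -split map_mxD !map_mxM addnC /=.
apply: leq_trans (mxrank_add _ _) _.
by rewrite leq_add // ?mxrankM_maxl ?mxrankM_maxr.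
Qed.

Definition exact_at (l m n : nat) (A : 'M[R]_(l, m)) (B : 'M[R]_(m, n)) :=
  forall x : 'cV_m, A *m x = 0 -> exists u y, phi u != 0 /\ u *: x = B *m y.

(** A contracting homotopy in the middle degree of the localized complex, with denominators
    cleared. *)
Definition split_at (l m n : nat) (A : 'M[R]_(l, m)) (B : 'M[R]_(m, n)) :=
  exists u s t, phi u != 0 /\ B *m s + t *m A = u%:M.

Lemma split_exact (l m n : nat) (A : 'M[R]_(l, m)) (B : 'M[R]_(m, n)) :
  split_at A B -> exact_at A B.
Proof.
move=> [u [s [t [u0 split]]]] x Ax0; exists u, (s *m x); split => //.
rewrite mulmxA -mul_scalar_mx -split mulmxDl -[t *m A *m x]mulmxA.
by rewrite Ax0 mulmx0 addr0.
Qed.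

(** The splitting one degree lower gives A s A = u A, because t C A = 0. Thus u - s A takes values
    in ker A, and it acts there as u. *)
Lemma mulmx_split_defect (k l m : nat) (C : 'M[R]_(k, l)) (A : 'M[R]_(l, m))
    u s t :
  C *m A = 0 -> A *m s + t *m C = u%:M -> A *m (u%:M - s *m A) = 0.
Proof.
move=> CA0 splitA; have -> : A *m (u%:M - s *m A) = u *: A - A *m s *m A.
  by rewrite mulmxBr mul_mx_scalar mulmxA.
have -> : A *m s = u%:M - t *m C by rewrite -splitA addrK.
by rewrite mulmxBl mul_scalar_mx -mulmxA CA0 mulmx0 subr0 subrr.
Qed.

Lemma exact_split (k l m n : nat) (C : 'M[R]_(k, l)) (A : 'M[R]_(l, m))
    (B : 'M[R]_(m, n)) :
  C *m A = 0 -> split_at C A -> exact_at A B -> split_at A B.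
Proof.
move=> CA0 [u [s [t [u0 splitA]]]] exB; pose Z := u%:M - s *m A.
have AZ0 : A *m Z = 0 := mulmx_split_defect CA0 splitA.
(* Each column of [Z] lies in ker A, hence lifts along [B] up to a multiplier [v j]. The product [w]
   of these serves all columns, and B S = w Z yields the splitting. *)
have /choice[v /choice[y vyP]] (j : 'I_m) :
    exists v y, phi v != 0 /\ v *: col j Z = B *m y.
  by apply: exB; rewrite colE mulmxA AZ0 mul0mx.
pose w := \prod_j v j; pose w' j := \prod_(i | i != j) v i.
have wE j : w = w' j * v j by rewrite /w (bigD1 j) //= mulrC.
pose S := \matrix_(i, j) (w' j * y j i 0).
have BS : B *m S = w *: Z.
  apply/matrixP => i j; have [_ /matrixP/(_ i 0)] := vyP j.
  rewrite !mxE (wE j) -mulrA => ->; rewrite mulr_sumr; apply: eq_bigr => q _.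
  by rewrite mxE mulrCA.
exists (w * u), S, (w *: s); split.
  rewrite rmorphM mulf_neq0 // rmorph_prod; apply/prodf_neq0 => j _.
  by case: (vyP j).
by rewrite BS -scalemxAl -scalerDr /Z subrK scale_scalar_mx.
Qed.

(* Exactness over K gives a matrix N = B T' + r s A congruent to a nonzero
   scalar modulo ker phi, so phi (det N) <> 0.  As A N = r u A, the multiple
   r u (adj N) preserves ker A, and on ker A the matrix N agrees with B T'. *)
Lemma rank_exact (k l m n : nat) (C : 'M[R]_(k, l)) (A : 'M[R]_(l, m))
    (B : 'M[R]_(m, n)) :
  C *m A = 0 -> A *m B = 0 -> split_at C A ->
  (\rank (map_mx phi A) + \rank (map_mx phi B) = m)%N -> exact_at A B.
Proof.
move=> CA0 AB0 [u [s [t [u0 splitA]]]] rkE; pose Z := u%:M - s *m A.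
have AZ0 : A *m Z = 0 := mulmx_split_defect CA0 splitA.
(* Over [K] the rank hypothesis makes im B all of ker A, which contains the columns of [Z]. The
   transposes turn column spaces into row spaces. *)
have [T BT] : exists T, map_mx phi Z = map_mx phi B *m T.
  have /submxP[T /(congr1 trmx) TE] :
      ((map_mx phi Z)^T <= (map_mx phi B)^T)%MS.
    have sub (W : 'M[K]_(m, _)) : map_mx phi A *m W = 0 ->
        (W^T <= kermx (map_mx phi A)^T)%MS.
      by move=> W0; rewrite sub_kermx -trmx_mul W0 trmx0.
    have BZ0 : map_mx phi A *m map_mx phi B = 0 by rewrite -map_mxM AB0 map_mx0.
    have rkker : (\rank (kermx (map_mx phi A)^T) <= \rank (map_mx phi B)^T)%N.
      by rewrite mxrank_ker !mxrank_tr leq_subLR rkE.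
    apply: submx_trans (sub _ _ _) _; first by rewrite -map_mxM AZ0 map_mx0.
    by rewrite -(geq_leqif (mxrank_leqif_sup (sub _ _ BZ0))).
  by exists T^T; rewrite -[LHS]trmxK TE trmx_mul trmxK.
have [T' [r [r0 T'E]]] := mx_common_denominator T.
pose N := B *m T' + r *: (s *m A).
have phiN : map_mx phi N = (phi (r * u))%:M.
  rewrite /N map_mxD map_mxM T'E map_mxZ -scalemxAr -BT /= -scalerDr -map_mxD.
  by rewrite subrK map_scalar_mx rmorphM scale_scalar_mx.
have detN : phi (\det N) != 0.
  by rewrite -det_map_mx phiN det_scalar expf_neq0 // rmorphM mulf_neq0.
have AN : A *m N = (r * u) *: A.
  rewrite /N mulmxDr mulmxA AB0 mul0mx add0r -scalemxAr -scalerA.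
  congr (_ *: _).
  have /eqP := AZ0; rewrite /Z mulmxBr subr_eq0 => /eqP <-.
  by rewrite mul_mx_scalar.
move=> x Ax0; pose y := (r * u) *: (\adj N *m x).
have Ay0 : A *m y = 0.
  rewrite /y -scalemxAr scalemxAl -AN -!mulmxA (mulmxA N) mul_mx_adj.
  by rewrite mul_scalar_mx -scalemxAr Ax0 scaler0.
exists (r * u * \det N), (T' *m y); split.
  by rewrite !rmorphM !mulf_neq0.
have : N *m y = B *m (T' *m y).
  by rewrite /N mulmxDl -scalemxAl -!mulmxA Ay0 mulmx0 scaler0 addr0.
by move=> <-; rewrite /y -scalemxAr mulmxA mul_mx_adj mul_scalar_mx scalerA.
Qed.

End SplitExact.

(** * The residue field at a prime *)

Section QuotientProjection.
Variables (R : comPzRingType) (I : ideal R).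

Definition qproj (x : R) : quotient_ring I := \pi x.

Lemma qproj_zmod_morphism : zmod_morphism qproj.
Proof.
move=> x y; rewrite /qproj pi_qadd; congr (_ + _).
exact: (Quotient.pi_opp (ideal_pred I : zmodClosed R)).
Qed.

Lemma qproj_monoid_morphism : monoid_morphism qproj.
Proof. by split=> // x y; exact: pi_qmul. Qed.

HB.instance Definition _ :=
  GRing.isZmodMorphism.Build R (quotient_ring I) qproj qproj_zmod_morphism.
HB.instance Definition _ :=
  GRing.isMonoidMorphism.Build R (quotient_ring I) qproj qproj_monoid_morphism.

Lemma qproj_surj (z : quotient_ring I) : exists x, qproj x = z.
Proof. by exists (repr z); rewrite /qproj reprK. Qed.

Lemma qproj_eq0 x : qproj x = 0 <-> ideal_set I x.
Proof.
rewrite -(rmorph0 qproj) /qproj pi_eqP subr0.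
by split=> [/asboolP|Ix]; last exact/asboolP.
Qed.

End QuotientProjection.

Section ResidueField.
Variables (R : comPzRingType) (p : spec R).

Definition residue_domain := quotient_ring (ideal_of_spec p).
HB.instance Definition _ := GRing.ComPzRing.on residue_domain.

Lemma residue_oner_neq0 : 1 != 0 :> residue_domain.
Proof.
have [_ p1 _] := specP p; apply/eqP => e; apply: p1.
by apply/(qproj_eq0 (ideal_of_spec p)); rewrite rmorph1.
Qed.

HB.instance Definition _ :=
  GRing.PzSemiRing_isNonZero.Build residue_domain residue_oner_neq0.

(** An integral domain structure comes with an inverse; it is chosen classically on units and is the
    identity elsewhere. *)
Definition residue_unit : {pred residue_domain} :=
  fun x => `[< exists y, y * x = 1 >].

Definition residue_inv (x : residue_domain) : residue_domain :=
  if pselect (exists y, y * x = 1) is left xU then projT1 (cid xU) else x.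

Lemma residue_mulVx : {in residue_unit, left_inverse 1 residue_inv *%R}.
Proof.
move=> x /asboolP xU; rewrite /residue_inv; case: pselect => // xU'.
by case: cid.
Qed.

Lemma residue_unitPl (x y : residue_domain) : y * x = 1 -> residue_unit x.
Proof. by move=> yx; apply/asboolP; exists y. Qed.

Lemma residue_invr_out : {in [predC residue_unit], residue_inv =1 id}.
Proof.
move=> x; rewrite inE => /asboolP xU; rewrite /residue_inv.
by case: pselect.
Qed.

HB.instance Definition _ := GRing.ComNzRing_hasMulInverse.Build residue_domain
  residue_mulVx residue_unitPl residue_invr_out.

Lemma residue_integral : GRing.integral_domain_axiom residue_domain.
Proof.
move=> x y; have [a <-] := qproj_surj x; have [b <-] := qproj_surj y.
have [_ _ pM] := specP p.
move=> ab0; have /pM[] : spec_set p (a * b).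
- by apply/(qproj_eq0 (ideal_of_spec p)); rewrite rmorphM.
- by move=> pa; apply/orP; left; apply/eqP/(qproj_eq0 (ideal_of_spec p)).
- by move=> pb; apply/orP; right; apply/eqP/(qproj_eq0 (ideal_of_spec p)).
Qed.

HB.instance Definition _ :=
  GRing.ComUnitRing_isIntegral.Build residue_domain residue_integral.

(** [K] is the fraction field of R/p, and fractions of residue classes lift to pairs of elements of
    R. *)
Lemma residue_field : exists (K : fieldType) (phi : {rmorphism R -> K}),
  (forall x, phi x = 0 <-> spec_set p x) /\
  (forall z : K, exists a s, phi s != 0 /\ phi s * z = phi a).
Proof.
pose pi : {rmorphism R -> residue_domain} := @qproj R (ideal_of_spec p).
pose tf : {rmorphism residue_domain -> {fraction residue_domain}} :=
  @FracField.tofrac _.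
exists {fraction residue_domain}, (tf \o pi : {rmorphism _ -> _}).
split=> [x|z].
  have pE : pi x = 0 <-> spec_set p x := qproj_eq0 (ideal_of_spec p) x.
  rewrite -pE /=; split=> [/eqP|->]; last exact: rmorph0.
  by rewrite tofrac_eq0 => /eqP.
have [n [d [d0 zE]]] : exists n d, d != 0 /\ tf d * z = tf n.
  elim/quotW: z => r; exists r.1, r.2; split; first exact: denom_ratioP.
  rewrite /tf /=; unlock FracField.tofrac.
  rewrite -[LHS]FracField.pi_mul; apply/eqP.
  rewrite FracField.equivf_def /FracField.mulf.
  rewrite !numden_Ratio ?mulf_neq0 ?oner_neq0 ?denom_ratioP //.
  by rewrite mul1r mulr1 mulrC.
have [a aE] := qproj_surj n; have [s sE] := qproj_surj d.
by exists a, s; rewrite /= aE sE tofrac_eq0.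
Qed.

End ResidueField.

(** In the application m is the rank of F_n and r the residual rank of the differential leaving it,
    so s is the largest rank [B] can have over [K]. That rank is reached exactly when some minor of
    size s is nonzero in [K]. *)
Lemma vanish_minors_rank (R : comPzRingType) (p : spec R) (K : fieldType)
    (phi : {rmorphism R -> K}) (m n r : nat) (s : int) (B : 'M[R]_(m, n)) :
    (forall x, phi x = 0 <-> spec_set p x) ->
    s = m%:Z - r%:Z -> (r + \rank (map_mx phi B) <= m)%N ->
  (~ minors s B `<=` spec_set p) <-> (r + \rank (map_mx phi B) = m)%N.
Proof.
move=> kerE sE le_m; rewrite /minors.
have p1 : ~ [set 1] `<=` spec_set p.
  by move=> /(_ 1 erefl) /kerE /eqP; rewrite rmorph1 oner_eq0.
have le_row := rank_leq_row (map_mx phi B).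
have le_col := rank_leq_col (map_mx phi B).
(* Here the only minor is 1, and the bound [le_m] is forced to be an equality: both sides hold. *)
case: ifP => [/orP s0|/negbT]; first by split=> // _; lia.
(* If s exceeds a dimension of [B], the only minor is 0 and the rank is below s: both sides fail. *)
rewrite negb_or => /andP[s0 mn0]; case: ifP => [lt_s|/negbT lt_s].
  split=> [[]|rE]; last by lia.
  by move=> _ ->; apply/kerE; rewrite rmorph0.
split=> [minors_p|rE].
  suff : (`|s| <= \rank (map_mx phi B))%N by lia.
  rewrite leqNgt; apply/negP => lt_rank; apply: minors_p => _ [f [g [_ _ ->]]].
  apply/kerE/eqP; apply: contraTT lt_rank => det_neq0.
  by rewrite -leqNgt (@minor_neq0_rank _ _ _ _ _ f g) // -map_mxsub det_map_mx.
have rank_s : \rank (map_mx phi B) = `|s|%N by lia.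
have [f [g [f_mono g_mono]]] := exists_minor_neq0 rank_s.
rewrite -map_mxsub det_map_mx => /eqP det_neq0 minors_p; apply: det_neq0.
by apply/kerE/minors_p; exists f, g.
Qed.

Lemma generated_subset (R : comPzRingType) (S : set R) (p : spec R) :
  generated S `<=` spec_set p <-> S `<=` spec_set p.
Proof.
split=> [gen_p x Sx|S_p x genx]; first by apply: gen_p => J [_]; apply.
by apply: genx; split=> //; case: (specP p).
Qed.

(** * The alternating sums of ranks *)

Section AltRank.
Variables (rk : int -> nat) (a : int).
Hypothesis rk_lt : forall n, n < a -> rk n = 0%N.

Lemma alt_rankE n : alt_rank rk n =
  \sum_(i \in [set i : int | a <= i <= n]) (-1) ^ (n - i) * (rk i)%:Z.
Proof.
apply/esym/fsbig_widen => [i /= /andP[]//|i /= [in_n /negP]].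
by rewrite in_n andbT -ltNge => /rk_lt ->; rewrite mulr0.
Qed.

Lemma alt_rank_lt n : n < a -> alt_rank rk n = 0.
Proof.
move=> na; apply: fsbig1 => i /= le_in; rewrite rk_lt ?mulr0 //.
exact: le_lt_trans na.
Qed.

Lemma finite_int_interval (b c : int) : finite_set [set i : int | b <= i <= c].
Proof.
apply: (@sub_finite_set _ _ [set b + k%:Z | k in `I_(`|c - b|.+1)]).
  by move=> i /= bic; exists `|i - b|%N; [rewrite /=|]; lia.
exact: finite_image.
Qed.

(** Once s_{n-1} is known to be the rank of the differential leaving F_n, this makes s_n the largest
    rank possible for the one entering F_n. *)
Lemma alt_rank_rec n : alt_rank rk n = (rk n)%:Z - alt_rank rk (n - 1).
Proof.
have [na|an] := ltP n a.
  by rewrite !alt_rank_lt ?rk_lt //; lia.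
rewrite !alt_rankE (fsbigD1 n) /=; first last.
- by rewrite an lexx.
- exact: finite_int_interval.
rewrite subrr expr0z mul1r -[X in _ = _ + X]mulN1r mulr_fsumr; congr (_ + _).
have -> : [set i | a <= i <= n] `\ n = [set i | a <= i <= n - 1].
  apply/seteqP; split=> i /=; first by case; lia.
  by move=> ain; split; lia.
apply: eq_fsbigr => i; rewrite inE /= => ain; rewrite mulrA; congr (_ * _).
have -> : n - i = n - 1 - i + 1 by lia.
by rewrite exprzDr ?unitrN1 // expr1z mulrC.
Qed.

End AltRank.

(** * Vanishing of localized homology *)

Lemma pi_qmod0 (R : pzRingType) (V : lmodType R) (W : submodClosed V) :
  \pi_(quotient_module W) 0 = 0.
Proof. by apply: (@addrI _ (\pi 0)); rewrite -pi_qmodD !addr0. Qed.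

(** A fraction z/s is zero exactly when some u outside p makes u z a boundary. The denominator s has
    no influence, so testing z/1 suffices. *)
Lemma homology_vanishP (R : comPzRingType) (X : complex R) (n : int)
    (p : spec R) :
  ~ localization_neq0 (homology X n) p <->
  (forall x : X n, diff X n (n - 1) x = 0 ->
     exists u y, ~ spec_set p u /\ u *: x = diff X (n + 1) n y).
Proof.
split=> [H0 x /eqP dx|H0 [h]].
  pose z : cycles X n := Sub x dx.
  pose h : homology X n := \pi z.
  have : Defs.frac h (outside1 p) = Defs.frac 0 (outside1 p).
    by apply: contrapT => h0; apply: H0; exists (Defs.frac h (outside1 p)).
  move=> /eqmodP/asboolP[[u /asboolP pu] /=].
  rewrite !scale1r subr0 => uh.
  have : \pi_(quotient_module (@boundary_pred _ X n)) (u *: z) = \pi 0.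
    by rewrite pi_qscale pi_qmod0; exact: uh.
  by move=> /pi_qmodE; rewrite subr0 => /asboolP[y dy]; exists u, y.
elim/quotW: h => -[h s]; apply; apply/eqmodP/asboolP.
elim/quotW: h => z.
have [u [y [pu uy]]] := H0 (val z) (eqP (valP z)).
have pu' : `[< ~ spec_set p u >] by apply/asboolP.
exists (Sub u pu') => /=; rewrite scaler0 subr0 scale1r.
rewrite -[LHS]pi_qscale -[RHS]pi_qmod0; apply/pi_qmodE; rewrite subr0.
by apply/asboolP; exists y.
Qed.

(** * Complexes of free modules in coordinates *)

Section FreeComplex.
Variables (R : comPzRingType) (F : complex R) (a : int) (rk : int -> nat).
Variable e : forall n : int, 'I_(rk n) -> F n.
Hypothesis e_basis : forall n : int, is_basis (@e n).
Hypothesis rk_lt : forall n : int, n < a -> rk n = 0%N.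

Definition basis_comb n (c : 'cV[R]_(rk n)) : F n := \sum_i c i 0 *: @e n i.

Lemma basis_comb_inj n : injective (@basis_comb n).
Proof.
move=> c c' cc'; have [f [_ f_uniq]] := e_basis (basis_comb c).
have /(_ c) fc : forall c0 : 'cV_(rk n), basis_comb c = basis_comb c0 ->
    f = [ffun i => c0 i 0].
  move=> c0 E; apply: f_uniq; rewrite E; apply: eq_bigr => i _.
  by rewrite ffunE.
have fc' : f = [ffun i => c' i 0].
  by apply: f_uniq; rewrite cc'; apply: eq_bigr => i _; rewrite ffunE.
apply/matrixP => i j; rewrite ord1.
by have := fc erefl; rewrite fc' => /ffunP/(_ i); rewrite !ffunE.
Qed.

Lemma basis_comb_surj n (x : F n) : exists c, basis_comb c = x.
Proof.
have [f [xE _]] := e_basis x; exists (\col_i f i).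
by rewrite xE; apply: eq_bigr => i _; rewrite mxE.
Qed.

Lemma basis_combZ n u (c : 'cV_(rk n)) :
  basis_comb (u *: c) = u *: basis_comb c.
Proof. by rewrite scaler_sumr; apply: eq_bigr => i _; rewrite mxE scalerA. Qed.

Lemma basis_comb0 n : basis_comb (0 : 'cV_(rk n)) = 0.
Proof. by rewrite -(scale0r 0) basis_combZ scale0r. Qed.

Lemma basis_comb_represents i j (M : 'M[R]_(rk j, rk i)) :
  represents (diff F i j) (@e i) (@e j) M ->
  forall c, diff F i j (basis_comb c) = basis_comb (M *m c).
Proof.
move=> MP c; rewrite linear_sum /basis_comb /=.
under eq_bigr => k _ do rewrite linearZ /= MP scaler_sumr.
rewrite exchange_big /=; apply: eq_bigr => k _.
rewrite mxE scaler_suml; apply: eq_bigr => l _.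
by rewrite scalerA mulrC.
Qed.

Lemma exists_represents i j :
  exists M, represents (diff F i j) (@e i) (@e j) M.
Proof.
have /choice[c cE] (k : 'I_(rk i)) :
    exists c : 'cV_(rk j), basis_comb c = diff F i j (@e i k).
  exact: basis_comb_surj.
exists (\matrix_(l, k) c k l 0) => k; rewrite -cE; apply: eq_bigr => l _.
by rewrite mxE.
Qed.

(* Indexed by both degrees, like [diff], so that [n - 1 + 1] can be rewritten to
   [n] without transporting matrices. *)
Definition diff_mx i j : 'M[R]_(rk j, rk i) :=
  projT1 (cid (exists_represents i j)).

Lemma diff_mxE i j c :
  diff F i j (basis_comb c) = basis_comb (diff_mx i j *m c).
Proof. by apply: basis_comb_represents; exact: (projT2 (cid _)). Qed.

(** Coordinates are unique, so the matrices given in the theorem are the chosen [diff_mx]. *)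
Lemma represents_diff_mx i j (M : 'M[R]_(rk j, rk i)) :
  represents (diff F i j) (@e i) (@e j) M -> M = diff_mx i j.
Proof.
move=> /basis_comb_represents ME; apply/matrixP => k l.
have /basis_comb_inj/matrixP/(_ k 0) : basis_comb (M *m delta_mx l 0) =
  basis_comb (diff_mx i j *m delta_mx l 0) by rewrite -ME diff_mxE.
by rewrite -!colE !mxE.
Qed.

Lemma diff_mxK i j k : diff_mx j k *m diff_mx i j = 0.
Proof.
apply/matrixP => l m.
have /basis_comb_inj/matrixP/(_ l 0) :
    basis_comb (diff_mx j k *m diff_mx i j *m delta_mx m 0) = basis_comb 0.
  by rewrite -mulmxA -!diff_mxE diffK basis_comb0.
by rewrite -colE !mxE.
Qed.

(** * Splitting, homology and minors at a fixed prime *)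

Section AtPrime.
Variables (p : spec R) (K : fieldType) (phi : {rmorphism R -> K}).
Hypothesis phi_ker : forall x, phi x = 0 <-> spec_set p x.
Hypothesis phi_frac :
  forall z : K, exists a s : R, phi s != 0 /\ phi s * z = phi a.

Let vanishing n := ~ localization_neq0 (homology F n) p.
Let minors_outside n :=
  ~ minors (alt_rank rk n) (diff_mx (n + 1) n) `<=` spec_set p.

Let split_in i j k := split_at phi (diff_mx j k) (diff_mx i j).
Let rank_in i j := (\rank (map_mx phi (diff_mx i j)))%:Z.

(** This is the state carried upwards by induction: it mentions degree n only, and the lower degrees
    enter through the value of the rank. *)
Definition split_below n := split_in (n + 1) n (n - 1) /\
  rank_in (n + 1) n = alt_rank rk n.

Lemma vanishingE n : vanishing n <->
  exact_at phi (diff_mx n (n - 1)) (diff_mx (n + 1) n).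
Proof.
have outE u : ~ spec_set p u <-> phi u != 0.
  by rewrite -phi_ker; split=> [/eqP|/eqP].
rewrite /vanishing homology_vanishP; split=> ex x x0.
  have [|u [y [pu]]] := ex (basis_comb x).
    by rewrite diff_mxE x0 basis_comb0.
  have [c <-] := basis_comb_surj y.
  rewrite diff_mxE -basis_combZ => /basis_comb_inj uE.
  by exists u, c; split=> //; apply/outE.
have [c cx] := basis_comb_surj x; move: x0; rewrite -cx diff_mxE -basis_comb0.
move=> /basis_comb_inj /ex[u [y [u0 uE]]]; exists u, (basis_comb y); split.
  exact/outE.
by rewrite -basis_combZ uE diff_mxE.
Qed.

Lemma split_below_step n : split_below (n - 1) ->
  (vanishing n <-> split_below n) /\ (minors_outside n <-> split_below n).
Proof.
rewrite /split_below subrK => -[split1 rank1].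
have rec := alt_rank_rec rk_lt n.
have splitP : vanishing n <-> split_in (n + 1) n (n - 1).
  rewrite vanishingE; split=> [ex|]; last exact: split_exact.
  exact: exact_split (diff_mxK _ _ _) split1 ex.
have rankP : split_in (n + 1) n (n - 1) <->
    (\rank (map_mx phi (diff_mx n (n - 1))) +
     \rank (map_mx phi (diff_mx (n + 1) n)) = rk n)%N.
  split=> [[u [s [t [u0 splitE]]]]|rkE].
    exact: split_rank u0 (diff_mxK _ _ _) splitE.
  (* From ranks back to a splitting the way leads through exactness, where the splitting in degree n
     - 1 is used. *)
  apply/splitP/vanishingE.
  exact: (rank_exact phi_frac (diff_mxK _ _ _) (diff_mxK _ _ _) split1 rkE).
have le_rk : (\rank (map_mx phi (diff_mx n (n - 1))) +
    \rank (map_mx phi (diff_mx (n + 1) n)) <= rk n)%N.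
  by apply: mulmx0_rank_max; rewrite -map_mxM diff_mxK map_mx0.
(* The rank clause follows from the splitting: the two ranks add up to [rk n], and s_n obeys the
   same recursion. *)
have below : split_in (n + 1) n (n - 1) <->
    split_in (n + 1) n (n - 1) /\ rank_in (n + 1) n = alt_rank rk n.
  split=> [split_n|[]//]; split=> //; move/rankP: split_n.
  by rewrite rec -rank1 /rank_in; lia.
rewrite -below; split=> //; rewrite rankP /minors_outside.
by apply: vanish_minors_rank => //; rewrite rec -rank1.
Qed.

Lemma split_below_lt n : n < a -> split_below n.
Proof.
move=> na; have rk0 := rk_lt na; split.
  exists 1, 0, 0; split; first by rewrite rmorph1 oner_neq0.
  (* As [rk n] is 0, the matrices compared have no rows. *)
  apply/matrixP => i; exfalso; have := ltn_ord i.
  by rewrite [X in (_ < X)%N -> _]rk0.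
rewrite (alt_rank_lt rk_lt na) /rank_in; congr Posz; apply/eqP.
by rewrite -leqn0 -rk0 rank_leq_row.
Qed.

(** Upward induction on the integers, started in the degrees below [a], where splitting is
    automatic. *)
Lemma split_below_ind (Q : int -> Prop) :
  (forall n, split_below (n - 1) -> Q n -> split_below n) ->
  forall n, (forall i, i <= n -> Q i) -> split_below n.
Proof.
move=> step n Qn; have [na|an] := ltP n a; first exact: split_below_lt.
have [k nE] : exists k : nat, n = a + k%:Z by exists `|n - a|%N; lia.
rewrite {}nE in Qn *; elim: k Qn {an} => [|k IH] Qn.
  by apply: step (Qn _ _) => //; apply: split_below_lt; lia.
apply: step; last exact: Qn.
have -> : a + k.+1%:Z - 1 = a + k%:Z by lia.
by apply: IH => i ik; apply: Qn; lia.
Qed.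

Lemma homology_neq0_ge n : localization_neq0 (homology F n) p -> a <= n.
Proof.
move=> Hn; rewrite leNgt; apply/negP => na.
have below_n : split_below (n - 1) by apply: split_below_lt; lia.
by have [[_ /(_ (split_below_lt na))]] := split_below_step below_n.
Qed.

(** Vanishing homology below n gives the splitting in degree n - 1. A minor outside p would extend
    it to degree n and so kill H_n at p. *)
Lemma minors_subset_of_first n : localization_neq0 (homology F n) p ->
  (forall i, localization_neq0 (homology F i) p -> n <= i) ->
  minors (alt_rank rk n) (diff_mx (n + 1) n) `<=` spec_set p.
Proof.
move=> Hn n_first; apply: contrapT => minors_n.
have below_n : split_below (n - 1).
  apply: (split_below_ind (Q := vanishing)) => [i below_i|i i_n Hi].
    by have [[]] := split_below_step below_i.
  by have := n_first _ Hi; lia.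
have [[_ to_vanish] [to_split _]] := split_below_step below_n.
exact: to_vanish (to_split minors_n) Hn.
Qed.

(** If the homology at p vanished in all degrees up to n, the complex would split there, and some
    minor would lie outside p. *)
Lemma exists_homology_neq0 n :
  minors (alt_rank rk n) (diff_mx (n + 1) n) `<=` spec_set p ->
  exists2 i, i <= n & localization_neq0 (homology F i) p.
Proof.
move=> minors_n; apply: contrapT => H0.
have vanish i : i <= n -> vanishing i by move=> i_n Hi; apply: H0; exists i.
have below i : i <= n -> split_below i.
  move=> i_n; apply: (split_below_ind (Q := vanishing)) => [j below_j|j j_i].
    by have [[]] := split_below_step below_j.
  exact: vanish (le_trans j_i i_n).
have below_n : split_below (n - 1) by apply: below; lia.
have [_ [_ to_minors]] := split_below_step below_n.
exact: to_minors (below _ (lexx n)) minors_n.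
Qed.

End AtPrime.
End FreeComplex.

(** * Suprema and infima of extended integers *)

Lemma int_has_max (A : set int) (b : int) : A !=set0 -> ubound A b ->
  exists2 m, A m & ubound A m.
Proof.
move=> [x Ax] Ab.
(* The maximum is the element at least distance k below the bound. *)
have ex : exists k : nat, `[< A (b - k%:Z) >].
  exists `|b - x|%N; apply/asboolP; have := Ab _ Ax.
  by move=> xb; have -> : b - `|b - x|%N%:Z = x by lia.
case: (ex_minnP ex) => k /asboolP Ak kmin.
exists (b - k%:Z) => // y Ay; have yb := Ab _ Ay.
have : `[< A (b - `|b - y|%N%:Z) >].
  by apply/asboolP; have -> : b - `|b - y|%N%:Z = y by lia.
by move=> /kmin; lia.
Qed.

Lemma int_has_min (A : set int) (b : int) : A !=set0 -> lbound A b ->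
  exists2 m, A m & lbound A m.
Proof.
move=> [x Ax] Ab; have [||m [y Ay <-] mmax] := @int_has_max (-%R @` A) (- b).
- by exists (- x), x.
- by move=> _ [y Ay <-]; rewrite lerN2; apply: Ab.
by exists y => // z Az; rewrite -lerN2; apply: mmax; exists z.
Qed.

(** This ensures that [esup] is a true supremum and not a default value. A set bounded by an integer
    has its largest integer as supremum, or -oo if it contains none; any other set, in particular
    one containing +oo, has supremum +oo. *)
Lemma supremums_ereal_int_neq0 (A : set (\bar int)) : supremums A !=set0.
Proof.
have [[b Ab]|unbounded] := pselect (exists b : int, ubound A b%:E).
  have [[x Ax]|noint] := pselect (exists x : int, A x%:E).
    have [||m Am mmax] := @int_has_max [set x : int | A x%:E] b.
    - by exists x.
    - by move=> y /Ab; rewrite lee_fin.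
    exists m%:E; split=> [[y|/Ab|_]|y]; last exact.
    - by move=> Ay; rewrite lee_fin; apply: mmax.
    - by rewrite leye_eq.
    - by rewrite leNye.
  exists -oo%E; split=> [[y Ay|/Ab|_]|y _]; rewrite ?leNye ?leye_eq //.
  by case: noint; exists y.
exists +oo%E; split=> [y _|[y yub||Ay]]; rewrite ?leey //.
  by case: unbounded; exists y.
case: unbounded; exists 0 => x /Ay.
by rewrite leeNy_eq => /eqP ->; rewrite leNye.
Qed.

Lemma esup_leP (A : set (\bar int)) (x : \bar int) :
  (esup A <= x)%E <-> ubound A x.
Proof.
rewrite /esup /supremum; case: ifPn => [/eqP ->|_].
  by rewrite leNye; split=> // _ y.
case: xgetP => [s _ [s_ub s_lub]|none].
  by split=> [sx y Ay|xub]; [apply: le_trans sx; apply: s_ub|apply: s_lub].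
by have [s /none] := supremums_ereal_int_neq0 A.
Qed.

Lemma esup_ubound (A : set (\bar int)) : ubound A (esup A).
Proof. by apply/esup_leP. Qed.

Lemma einf_min (A : set int) (m : int) : A m -> lbound A m ->
  einf [set n%:E | n in A] = m%:E.
Proof.
move=> Am m_lb; rewrite /einf /infimum ifF; last first.
  apply/negP => /eqP A0.
  by have : [set n%:E | n in A] m%:E by [exists m]; rewrite A0.
have m_inf : infimums [set n%:E | n in A] m%:E.
  split=> [_ [y Ay <-]|y y_lb]; first by rewrite lee_fin; apply: m_lb.
  by apply: y_lb; exists m.
case: xgetP => [s _ s_inf|/(_ m%:E)//].
exact: is_subset1_infimums s_inf m_inf.
Qed.

(** Image and preimage match the primes of R/I with the primes of R containing I, so dimensions of
    different quotients can be compared through chains in R itself. *)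
Lemma dim_quotient_leP (R : comPzRingType) (I : ideal R) (x : \bar int) :
  (dim_quotient I <= x)%E <->
  forall l (q : nat -> set R), prime_chain l q -> ideal_set I `<=` q 0%N ->
    ((l%:Z)%:E <= x)%E.
Proof.
rewrite /dim_quotient /krull_dim esup_leP.
have [I0 ID IM] := idealP I.
split=> [ub l q [q_prime q_lt] Iq|chains _ [l [q [q_prime q_lt]] <-]].
  have Iqi i : (i <= l)%N -> ideal_set I `<=` q i.
    elim: i => [//|i IH] il; apply: subset_trans (IH (ltnW il)) _.
    by have [] := q_lt i il.
  (* Since [q i] contains [I], it is the full preimage of its image; primality and strict inclusions
     pass to the images by this. *)
  have imE i t : (i <= l)%N -> (@qproj _ I @` q i) (qproj I t) -> q i t.
    move=> il [y qy /pi_eqP/asboolP Iyt].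
    have [[_ qD qM] _ _] := q_prime i il.
    have -> : t = y + -1 * (y - t) by rewrite mulN1r opprB addrC subrK.
    by apply: qD => //; apply: qM; apply: Iqi Iyt.
  apply: ub; exists l => //; exists (fun i => @qproj _ I @` q i); split=> i il.
    have [[q0 qD qM] q1 qprime] := q_prime i il; split.
    - split; first by exists 0; rewrite ?rmorph0.
        move=> _ _ [t qt <-] [y qy <-].
        by exists (t + y); rewrite ?rmorphD //; apply: qD.
      move=> z _ [t qt <-]; have [c <-] := qproj_surj z.
      by exists (c * t); rewrite ?rmorphM //; apply: qM.
    - by rewrite -(rmorph1 (qproj I)) => /(imE _ _ il).
    - move=> y z; have [c <-] := qproj_surj y; have [d <-] := qproj_surj z.
      rewrite -rmorphM => /(imE _ _ il)/qprime[qc|qd]; [left|right].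
        by exists c.
      by exists d.
  have [sub nsub] := q_lt i il; split=> [_ [t qt <-]|sub'].
    by exists t => //; apply: sub.
  by apply: nsub => t qt; apply: imE (ltnW il) _; apply: sub'; exists t.
have pre_prime i : (i <= l)%N -> is_prime (@qproj _ I @^-1` q i).
  move=> il; have [[q0 qD qM] q1 qprime] := q_prime i il; split.
  - split=> [|t y qt qy|c t qt]; rewrite /preimage /=;
      rewrite ?rmorph0 ?rmorphD ?rmorphM //.
      exact: qD.
    exact: qM.
  - by rewrite /preimage /= rmorph1.
  - by move=> t y; rewrite /preimage /= rmorphM; apply: qprime.
apply: (chains l (fun i => @qproj _ I @^-1` q i)); last first.
  move=> t /(qproj_eq0 I) t0; rewrite /preimage /= t0.
  by have [[]] := q_prime 0%N (leq0n l).
split=> // i il; have [sub nsub] := q_lt i il.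
split=> [t|sub']; first exact: sub.
by apply: nsub => z; have [t <-] := qproj_surj z; exact: sub'.
Qed.

Lemma chain_le_dim_quotient (R : comPzRingType) (I : ideal R) l
    (q : nat -> set R) :
  prime_chain l q -> ideal_set I `<=` q 0%N -> ((l%:Z)%:E <= dim_quotient I)%E.
Proof. exact: (proj1 (dim_quotient_leP I _) (lexx _)). Qed.

Theorem theorem1 (R : comPzRingType) (R_noeth : noetherian R)
    (F : complex R) (a b : int) (rk : int -> nat)
    (e : forall n : int, 'I_(rk n) -> F n)
    (e_basis : forall n : int, is_basis (e n))
    (F_bounded : forall n : int, ~~ (a <= n <= b) -> rk n = 0%N)
    (D : forall n : int, 'M[R]_(rk n, rk (n + 1)))
    (D_repr : forall n : int,
      represents (diff F (n + 1) n) (e (n + 1)) (e n) (D n)) :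
  dim_complex F =
  esup [set (dim_quotient (minors_ideal (alt_rank rk n) (D n)) - n%:E)%E
       | n in [set: int]].
Proof.
have rk_lt n : n < a -> rk n = 0%N by move=> na; apply: F_bounded; lia.
have DE n : D n = diff_mx e_basis (n + 1) n by exact: represents_diff_mx.
pose Hsupp p := [set n : int | localization_neq0 (homology F n) p].
have Hsupp_min p : Hsupp p !=set0 -> exists2 m, Hsupp p m & lbound (Hsupp p) m.
  have [K [phi [phi_ker phi_frac]]] := residue_field p => H0.
  apply: (int_has_min H0 (b := a)) => n Hn.
  exact: (homology_neq0_ge e_basis rk_lt phi_ker phi_frac Hn).
apply/le_anti/andP; split; apply/esup_leP.
  move=> _ [p _ <-]; rewrite /inf_homology_at -/(Hsupp p).
  (* Without homology at [p] the infimum is +oo and the contribution -oo. Otherwise the infimum is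
     the least degree [m], and the term for [m] on the right dominates: p contains I_{s_m}, so
     chains above p are chains above I_{s_m}. *)
  have [H0|/set0P/Hsupp_min[m Hm m_lb]] := eqVneq (Hsupp p) set0.
    rewrite H0 image_set0 /einf /infimum eqxx /= addeNy; exact: leNye.
  rewrite (einf_min Hm m_lb).
  have [K [phi [phi_ker phi_frac]]] := residue_field p.
  have := minors_subset_of_first (e_basis := e_basis)
    rk_lt phi_ker phi_frac Hm m_lb.
  rewrite -DE => /generated_subset I_p.
  apply: le_trans (esup_ubound (ex_intro2 _ _ m I erefl)).
  apply: leeB => //; apply/dim_quotient_leP => l q ql pq.
  by apply: chain_le_dim_quotient ql _; apply: subset_trans I_p pq.
move=> _ [n _ <-]; rewrite leeBlDr //; apply/dim_quotient_leP => l q ql I_q.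
pose p := Spec (ql.1 0%N (leq0n l)).
have [K [phi [phi_ker phi_frac]]] := residue_field p.
move/generated_subset: (I_q : _ `<=` spec_set p); rewrite DE => minors_p.
have [i i_n Hi] := exists_homology_neq0 rk_lt phi_ker phi_frac minors_p.
have [m Hm m_lb] := Hsupp_min p (ex_intro _ i Hi).
rewrite -leeBlDr //; apply: le_trans (esup_ubound (ex_intro2 _ _ p I erefl)).
rewrite /inf_homology_at -/(Hsupp p) (einf_min Hm m_lb); apply: leeB.
  exact: (@chain_le_dim_quotient _ (ideal_of_spec p) l q ql (fun=> id)).
by rewrite lee_fin; apply: le_trans i_n; apply: m_lb.
Qed.
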